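(* Let $K$ be an upward isotone cone in a Banach space $X$ that induces a partial order $\succcurlyeq$ on $X$. Let $f:K\to X$ be a mapping. Suppose that the following conditions are satisfied: a) $(X,\succcurlyeq)$ is chain-complete; b) for every $x\in X$, $P_K(x)$ is universally inductive in $(X,\succcurlyeq)$; c) $f$ is $\succcurlyeq$-increasing; d) there is $y_*\in K$ such that $P_K(f(y_* ))\subseteq(y_*]$. Then $f$ has a best approximation point on $K$. Moreover, $(\mathcal{B}(f)\cap(y_*],\succcurlyeq)$ is a nonempty inductive poset.
   Context: Banach spaces are real. A nonempty closed convex cone $K\subseteq X$ induces the order $x\succcurlyeq y$ (equivalently $y\preccurlyeq x$) iff $x-y\in K$, which is a partial order (so $K\cap(-K)=\{0\}$). The metric projection is $P_K(x)=\{x'\in K:\|x-x'\|=\inf_{z\in K}\|x-z\|\}$. $K$ is an upward isotone cone if it is a nonempty closed convex cone such that $P_K(x)\neq\emptyset$ for every $x\in X$ and $P_K$ is $\succcurlyeq$-increasing upward, i.e. whenever $x\preccurlyeq y$ in $X$ and $z\in P_K(x)$, there is $w\in P_K(y)$ with $z\preccurlyeq w$. A chain is a nonempty totally ordered subset. The partially ordered Banach space $(X,\succcurlyeq)$ is chain-complete if every chain in $X$ that has an upper bound has a least upper bound in $X$. A poset is inductive if every chain in it has an upper bound in it. A nonempty subset $A\subseteq X$ is universally inductive in $X$ if, for every chain $\{x_\alpha\}\subseteq X$ such that for every element $x_\beta$ of the chain there is $a\in A$ with $x_\beta\preccurlyeq a$, the chain has an upper bound belonging to $A$. The mapping $f$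 is $\succcurlyeq$-increasing if $x\preccurlyeq y$ in $K$ implies $f(x)\preccurlyeq f(y)$. A point $x_0\in K$ is a best approximation point for $f$ on $K$ if $x_0\in P_K(f(x_0))$, i.e. $\|f(x_0)-x_0\|=\inf_{z\in K}\|f(x_0)-z\|$; $\mathcal{B}(f)$ is the set of all such points. $(y]=\{x\in X:x\preccurlyeq y\}$. *)

(* Defs.v *)
From HB Require Import structures.
From mathcomp Require Export all_boot all_order all_algebra.
From mathcomp Require Export all_classical all_reals all_analysis.
Export Order.TTheory GRing.Theory Num.Theory.
Export numFieldNormedType.Exports.

Set Implicit Arguments.
Unset Strict Implicit.
Unset Printing Implicit Defensive.

Local Open Scope classical_set_scope.
Local Open Scope ring_scope.

(* The order induced by a cone depends on the cone, so it is kept as a plain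
   relation rather than as a canonical porderType instance; [le x y] reads
   "x is below y". *)

Definition partial_order_on (T : Type) (A : set T) (le : T -> T -> Prop) :=
  [/\ forall x, A x -> le x x,
      forall x y, A x -> A y -> le x y -> le y x -> x = y
    & forall x y z, A x -> A y -> A z -> le x y -> le y z -> le x z].

Definition upper_bound (T : Type) (le : T -> T -> Prop) (C : set T) (u : T) :=
  forall x, C x -> le x u.

Definition least_upper_bound (T : Type) (le : T -> T -> Prop) (C : set T)
    (u : T) :=
  upper_bound le C u /\ forall v, upper_bound le C v -> le u v.

Definition lower_section (T : Type) (le : T -> T -> Prop) (y : T) : set T :=
  [set x | le x y].

Definition chain (T : Type) (le : T -> T -> Prop) (C : set T) :=
  C !=set0 /\ total_on C le.

Definition chain_complete (T : Type) (le : T -> T -> Prop) :=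
  forall C : set T, chain le C -> (exists u, upper_bound le C u) ->
    exists s, least_upper_bound le C s.

Definition inductive_poset (T : Type) (le : T -> T -> Prop) (A : set T) :=
  partial_order_on A le /\
  forall C : set T, C `<=` A -> chain le C ->
    exists2 u, A u & upper_bound le C u.

Definition universally_inductive (T : Type) (le : T -> T -> Prop) (A : set T) :=
  A !=set0 /\
  forall C : set T, chain le C -> (forall x, C x -> exists2 a, A a & le x a) ->
    exists2 u, A u & upper_bound le C u.

Definition cone_le (R : realType) (X : normedModType R) (K : set X) (x y : X) :=
  K (y - x).

Definition closed_convex_cone (R : realType) (X : normedModType R)
    (K : set X) :=
  [/\ K !=set0, closed K, convex_set K
    & forall (t : R) (x : X), 0 <= t -> K x -> K (t *: x)].

Definition metric_proj (R : realType) (X : normedModType R) (K : set X)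
    (x : X) : set X :=
  [set x' | K x' /\ `|x - x'| = inf [set `|x - z| | z in K]].

Definition increasing_upward (T : Type) (le : T -> T -> Prop)
    (F : T -> set T) :=
  forall x y z, le x y -> F x z -> exists2 w, F y w & le z w.

Definition upward_isotone_cone (R : realType) (X : normedModType R)
    (K : set X) :=
  [/\ closed_convex_cone K,
      forall x, metric_proj K x !=set0
    & increasing_upward (cone_le K) (metric_proj K)].

Definition increasing_on (R : realType) (X : normedModType R) (K : set X)
    (f : set_type K -> X) :=
  forall x y : set_type K,
    cone_le K (val x) (val y) -> cone_le K (f x) (f y).

Definition best_approximation (R : realType) (X : normedModType R) (K : set X)
    (f : set_type K -> X) : set X :=
  [set val x | x in [set x : set_type K | metric_proj K (f x) (val x)]].

(* Main.v *)
Require Import Defs.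

Set Implicit Arguments.
Unset Strict Implicit.
Unset Printing Implicit Defensive.

(** A best approximation point of [f] is a fixed point of the set-valued map
    [x |-> P_K (f x)], and everything about this map that matters is
    order-theoretic.  It is increasing upward, and it sends the order interval
    [K `&` (y]] into itself: a value at [x <= y] lies below some value at [y],
    and these are below [y] by assumption.

    The fixed point theorem comes from the ascending points, those [x] lying
    below some element of [F x].  Let [s] be the supremum of a chain of
    ascending points.  Each member of the chain lies below an element of its
    own image, hence below an element of [F s]; as [F s] is universally
    inductive, a single element of [F s] bounds the whole chain, hence bounds
    [s], so that [s] is again ascending ([ascending_sup]).  By Zorn's lemma
    every ascending point lies below a maximal one.  A maximal ascending point
    [m] lies below some [z] in [F m], the element [z] is ascending by
    monotonicity, hence [z = m] and [m] is a fixed point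
    ([fixed_point_above]).

    Fixed points are ascending, so the supremum of a chain of fixed points is
    ascending, and a fixed point above it bounds the chain: the fixed points
    form an inductive poset.  There is at least one, above the point [0],
    which is ascending because the induced order makes [0] the least element
    of [K]. *)

Local Open Scope classical_set_scope.
Local Open Scope ring_scope.

(** * Maximal elements above a given element *)

(** Zorn's lemma on the elements of [A] above [a], a subset in which the empty
    chain is bounded by [a] itself. *)
Lemma inductive_poset_maximal_above (T : Type) (le : T -> T -> Prop)
    (A : set T) (a : T) :
  inductive_poset le A -> A a ->
  exists m, [/\ A m, le a m & forall x, A x -> le m x -> x = m].
Proof.
move=> [[le_refl le_anti le_trans] A_ind] Aa.
pose S := {x | A x /\ le a x}.
pose R (u v : S) := `[< le (sval u) (sval v) >].
have [||||[m [Am am]] m_max] := @Zorn S R.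
- by move=> [x [Ax ax]]; apply/asboolP; exact: le_refl.
- move=> [x [Ax ax]] [z [Az az]] [w [Aw aw]] /asboolP /= xz /asboolP /= zw.
  by apply/asboolP; exact: (le_trans _ z).
- move=> [x [Ax ax]] [z [Az az]] /asboolP /= xz /asboolP /= zx.
  by apply: eq_exist; exact: le_anti.
- move=> B B_total.
  have [[b Bb]|B0] := pselect (B !=set0); last first.
    exists (exist _ a (conj Aa (le_refl _ Aa))) => s Bs.
    by case: B0; exists s.
  have [||u Au u_ub] := A_ind (sval @` B).
  + by move=> _ [[x [Ax ax]] _ <-].
  + split; first by exists (sval b), b.
    move=> _ _ [s Bs <-] [t Bt <-].
    by have [/asboolP|/asboolP] := B_total s t Bs Bt; [left|right].
  + have au : le a u.
      have bu : le (sval b) u by apply: u_ub; exists b.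
      by case: b Bb bu => /= x [Ax ax] _; exact: le_trans.
    exists (exist _ u (conj Au au)) => s Bs.
    by apply/asboolP; apply: u_ub; exists s.
exists m; split=> // x Ax mx.
have ax : le a x by exact: (le_trans _ m).
have := m_max (exist _ x (conj Ax ax)) (asboolT mx).
by move/(congr1 sval).
Qed.

(** * Fixed points of increasing set-valued maps *)

Definition ascending (T : Type) (le : T -> T -> Prop) (F : T -> set T) :
    set T :=
  [set x | exists2 z, F x z & le x z].

(** The set [D], stable under [F], will be the order interval [K `&` (y]].
    Suprema and monotonicity are asked for on [D] only, since the map of
    interest is empty outside [K]. *)
Section FixedPoints.
Variables (T : Type) (le : T -> T -> Prop) (D : set T) (F : T -> set T).
Hypothesis le_order : partial_order_on setT le.
Hypothesis D_sup : forall C, C `<=` D -> chain le C ->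
  exists2 s, D s & least_upper_bound le C s.
Hypothesis F_stable : forall x, D x -> F x `<=` D.
Hypothesis F_increasing : forall x x' z, D x -> D x' -> le x x' -> F x z ->
  exists2 w, F x' w & le z w.
Hypothesis F_inductive : forall x, D x -> universally_inductive le (F x).

Lemma partial_order_on_sub (A : set T) : partial_order_on A le.
Proof.
have [le_refl le_anti le_trans] := le_order.
split=> [x _|x z _ _|x z w _ _ _]; first exact: le_refl.
- exact: le_anti.
- exact: le_trans.
Qed.

(** Monotonicity moves the witnesses of all the members of the chain into the
    one set [F s], where universal inductivity merges them. *)
Lemma ascending_sup (C : set T) (s : T) :
  C `<=` D `&` ascending le F -> chain le C -> D s ->
  least_upper_bound le C s -> ascending le F s.
Proof.
have [_ _ le_trans] := le_order.
move=> CA C_chain Ds [s_ub s_least].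
have [_ F_ub] := F_inductive Ds.
have [c Cc|w Fsw w_ub] := F_ub C C_chain; last first.
  by exists w => //; exact: s_least.
have [Dc [z Fcz cz]] := CA _ Cc.
have [w Fsw zw] := F_increasing Dc Ds (s_ub _ Cc) Fcz.
by exists w => //; exact: (le_trans _ z).
Qed.

Lemma ascending_inductive : inductive_poset le (D `&` ascending le F).
Proof.
split; first exact: partial_order_on_sub.
move=> C CA C_chain.
have [s Ds s_lub] := D_sup (fun x Cx => (CA x Cx).1) C_chain.
exists s; last exact: s_lub.1.
by split=> //; exact: (ascending_sup CA).
Qed.

(** Maximal ascending points are fixed, since [F] maps them to ascending
    points above them. *)
Lemma fixed_point_above (a : T) :
  D a -> ascending le F a -> exists x, [/\ D x, F x x & le a x].
Proof.
move=> Da a_asc.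
have [m [[Dm [z Fmz mz]] am m_max]] :=
  inductive_poset_maximal_above ascending_inductive (conj Da a_asc).
have Dz := F_stable Dm Fmz.
have z_asc : ascending le F z by exact: (F_increasing Dm).
by exists m; split=> //; rewrite -{2}(m_max z (conj Dz z_asc) mz).
Qed.

Lemma fixed_points_inductive : inductive_poset le (D `&` [set x | F x x]).
Proof.
have [le_refl _ le_trans] := le_order.
split; first exact: partial_order_on_sub.
move=> C CF C_chain.
have [s Ds s_lub] := D_sup (fun x Cx => (CF x Cx).1) C_chain.
have CA : C `<=` D `&` ascending le F.
  by move=> x /CF [Dx Fxx]; split=> //; exists x => //; exact: le_refl.
have [x [Dx Fxx sx]] :=
  fixed_point_above Ds (ascending_sup CA C_chain Ds s_lub).
exists x => // c Cc.
by apply: (le_trans _ s) => //; exact: s_lub.1.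
Qed.

End FixedPoints.

(** * Best approximation points *)

(** The map [x |-> P_K (f x)], with the empty value outside [K].  Extending it
    to the whole space lets its values be compared with its arguments without
    membership proofs. *)
Definition approximation_map (R : realType) (X : normedModType R) (K : set X)
    (f : set_type K -> X) (x : X) : set X :=
  [set z | exists2 k : set_type K, val k = x & metric_proj K (f k) z].

Lemma approximation_mapE (R : realType) (X : normedModType R) (K : set X)
    (f : set_type K -> X) (k : set_type K) :
  approximation_map f (val k) = metric_proj K (f k).
Proof.
apply/seteqP; split=> z; last by exists k.
by case=> k' /val_inj ->.
Qed.

Lemma best_approximation_fixed (R : realType) (X : normedModType R)
    (K : set X) (f : set_type K -> X) :
  best_approximation f = K `&` [set x | approximation_map f x x].
Proof.
apply/seteqP; split=> [_ [k fk <-]|x [_ [k kx fk]]]; last first.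
  by exists k; rewrite /= ?kx.
by split; [exact: set_valP|rewrite /= approximation_mapE].
Qed.

Lemma cone_le0 (R : realType) (X : normedModType R) (K : set X) (x : X) :
  cone_le K 0 x = K x.
Proof. by rewrite /cone_le subr0. Qed.

Theorem theorem6p2 (R : realType) (X : completeNormedModType R) (K : set X)
    (f : set_type K -> X) (y : set_type K)
    (K_isotone : upward_isotone_cone K)
    (K_order : partial_order_on setT (cone_le K))
    (X_complete : chain_complete (cone_le K))
    (proj_inductive : forall x : X,
       universally_inductive (cone_le K) (metric_proj K x))
    (f_increasing : increasing_on f)
    (proj_le : metric_proj K (f y) `<=` lower_section (cone_le K) (val y)) :
  best_approximation f !=set0 /\
  (best_approximation f `&` lower_section (cone_le K) (val y) !=set0 /\
   inductive_poset (cone_le K)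
     (best_approximation f `&` lower_section (cone_le K) (val y))).
Proof.
have [le_refl _ le_trans] := K_order.
have [_ proj_nonempty proj_increasing] := K_isotone.
set le := cone_le K in le_refl le_trans *.
set D := K `&` lower_section le (val y).
set F := approximation_map f.
have F_val x (Kx : K x) : exists2 k : set_type K, val k = x &
    F x = metric_proj K (f k).
  exists (SigSub (mem_set Kx)) => //.
  by rewrite -approximation_mapE.
have K0 : K 0 by have := le_refl 0 I; rewrite /le cone_le0.
have D_sup C : C `<=` D -> chain le C ->
    exists2 s, D s & least_upper_bound le C s.
  move=> CD C_chain.
  have y_ub : upper_bound le C (val y) by move=> x /CD [].
  (* The supremum stays in [K], the set of elements above [0], because it is
     above some member of the nonempty chain. *)
  have [s [s_ub s_least]] := X_complete C C_chain (ex_intro _ _ y_ub).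
  exists s => //; split; last exact: s_least.
  have [[c Cc] _] := C_chain.
  rewrite -cone_le0; apply: (le_trans _ c) => //; last exact: s_ub.
  by rewrite /le cone_le0; exact: (CD _ Cc).1.
have F_increasing x x' z : K x -> K x' -> le x x' -> F x z ->
    exists2 w, F x' w & le z w.
  move=> /F_val[k <- ->] /F_val[k' <- ->] kk'.
  exact: proj_increasing (f_increasing _ _ kk').
have F_stable x : D x -> F x `<=` D.
  move=> [Kx xy] z Fxz; split.
    by have [k _ FE] := F_val x Kx; move: Fxz; rewrite FE => -[].
  have [w Fyw zw] := F_increasing _ _ _ Kx (set_valP y) xy Fxz.
  apply: (le_trans _ w) => //; apply: proj_le.
  by rewrite -approximation_mapE.
have D_increasing x x' z : D x -> D x' -> le x x' -> F x z ->
    exists2 w, F x' w & le z w.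
  by move=> [Kx _] [Kx' _]; exact: F_increasing.
have F_inductive x : D x -> universally_inductive le (F x).
  by move=> [/F_val[k _ ->] _]; exact: proj_inductive.
have D0 : D 0.
  by split=> //; rewrite /lower_section /= /le cone_le0; exact: set_valP.
have asc0 : ascending le F 0.
  have [k _ F0] := F_val 0 K0.
  have [z [Kz Pz]] := proj_nonempty (f k).
  by exists z; rewrite ?F0 // /le cone_le0.
have [x [[Kx xy] Fxx _]] :=
  fixed_point_above K_order D_sup F_stable D_increasing F_inductive D0 asc0.
have fixedE : best_approximation f `&` lower_section le (val y) =
    D `&` [set x | F x x].
  by rewrite best_approximation_fixed setIAC.
split; first by exists x; rewrite best_approximation_fixed.
split; first by exists x; rewrite fixedE.
rewrite fixedE.
exact: fixed_points_inductive K_order D_sup F_stable D_increasing F_inductive.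
Qed.
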